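(* Let $(\{R_i\}_{i\geq 0}, \{t_i\}_{i\geq 0})$ be a perfectoid tower arising from some pair $(R, I_{0})$, and let $\{I_i\}_{i\geq 0}$ be its system of perfectoid pillars. Let $(\{R^{s.\flat}_{i}\}_{i\geq 0}, \{t^{s.\flat}_{i}\}_{i\geq 0})$ denote its tilt associated to $(R, I_{0})$. Then the following assertions hold. (1) For every $j\geq 0$ and every element $f^{s.\flat}_{j}\in R^{s.\flat}_{j}$, the following conditions are equivalent: (a) $f_{j}^{s.\flat}$ is a generator of the ideal $I_{j}^{s.\flat}$; (b) for every $i\geq 0$, $\Phi^{(j)}_{i}(f^{s.\flat}_{j})$ is a generator of the ideal $I_{j+i}\overline{R_{j+i}}$. In particular, $I^{s.\flat}_j$ is a principal ideal, and $(I^{s.\flat}_{j+1})^{p}=I^{s.\flat}_jR_{j+1}^{s.\flat}$. (2) There are isomorphisms of (possibly) non-unital rings $(R_j^{s.\flat})_{I^{s.\flat}_0\text{-tor}}\cong (R_j)_{I_{0}\text{-tor}}$ $(j\geq 0)$ that are compatible with $\{t_j\}_{j\geq 0}$ and $\{t^{s.\flat}_j\}_{j\geq 0}$.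
   Context: Fix a prime $p$. All rings are commutative and unital unless called non-unital. A pair $(R,I_0)$ is a ring with an ideal. A tower of rings $(\{R_i\}_{i\ge 0},\{t_i\}_{i\ge 0})$ is a sequence of rings with ring maps $t_i:R_i\to R_{i+1}$; each $R_i$ is an algebra over $R_j$ ($j\le i$) via these maps. Torsion: for an ideal $I$ of a ring $A$ and an $A$-module $M$, $M_{I\text{-tor}}$ is the submodule of those $m\in M$ such that for every $x\in I$ there is $n>0$ with $x^nm=0$. Purely inseparable tower arising from $(R,I_0)$: (a) $R_0=R$ and $p\in I_0$; (b) for each $i\ge0$ the map $\overline{t_i}:R_i/I_0R_i\to R_{i+1}/I_0R_{i+1}$ induced by $t_i$ is injective; (c) for each $i\ge0$ the image of the Frobenius endomorphism of $R_{i+1}/I_0R_{i+1}$ is contained in the image of $\overline{t_i}$. Write $\overline{R_i}:=R_i/I_0R_i$. The $i$-th Frobenius projection is the unique ring map $F_i:\overline{R_{i+1}}\to\overline{R_i}$ such that $\overline{t_i}\circ F_i$ is the Frobenius endomorphism of $\overline{R_{i+1}}$. Perfectoid tower arising from $(R,I_0)$: a purely inseparable tower arising from $(R,I_0)$ such that moreover: (d) every $F_i$ is surjective; (e) every $I_0R_i$ is contained in the Jacobson radical of $R_i$; (f) $I_0$ is principal, and $R_1$ contains a principal ideal $I_1$ with (f-1) $I_1^p=I_0R_1$ and (f-2) $\ker(F_i)=I_1\overline{R_{i+1}}$ for every $i\ge0$; (g) for every $i\ge0$, $I_0(R_i)_{I_0\text{-tor}}=(0)$, and there is a (unique) bijection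 $(F_i)_{\mathrm{tor}}:(R_{i+1})_{I_0\text{-tor}}\to(R_i)_{I_0\text{-tor}}$ compatible with $F_i$ under the natural maps $(R_k)_{I_0\text{-tor}}\hookrightarrow R_k\twoheadrightarrow\overline{R_k}$, $k=i,i+1$. Perfectoid pillars: the ideal $I_1$ in (f) is unique, and there is a unique sequence of principal ideals $\{I_i\subseteq R_i\}_{i\ge0}$ extending $I_0,I_1$ with $F_i^{-1}(I_i\overline{R_i})=I_{i+1}\overline{R_{i+1}}$ for every $i\ge0$; $I_i$ is the $i$-th perfectoid pillar. Tilt: $R_j^{s.\flat}:=\varprojlim\{\cdots\xrightarrow{F_{j+1}}\overline{R_{j+1}}\xrightarrow{F_j}\overline{R_j}\}$, with $t_j^{s.\flat}:R_j^{s.\flat}\to R_{j+1}^{s.\flat}$, $(a_i)_{i\ge0}\mapsto(\overline{t_{j+i}}(a_i))_{i\ge0}$. For $m\ge0$, $\Phi^{(j)}_m:R_j^{s.\flat}\to\overline{R_{j+m}}$, $(a_i)_{i\ge0}\mapsto a_m$. The ideal $I_j^{s.\flat}\subseteq R_j^{s.\flat}$ is the kernel of the composite $R_j^{s.\flat}\xrightarrow{\Phi^{(j)}_0}\overline{R_j}\twoheadrightarrow R_j/I_j$. In (2), $(R_j^{s.\flat})_{I_0^{s.\flat}\text{-tor}}$ is the torsion with respect to $I_0^{s.\flat}$, where $R_j^{s.\flat}$ is an $R_0^{s.\flat}$-algebra via the transition maps. *)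

(* Defs.v *)
From HB Require Import structures.
From mathcomp Require Import all_boot all_order all_algebra.
From mathcomp Require Import boolp classical_sets functions.

Set Implicit Arguments.
Unset Strict Implicit.
Unset Printing Implicit Defensive.

Import GRing.Theory.
Local Open Scope ring_scope.
Local Open Scope classical_set_scope.
Local Open Scope quotient_scope.

(* Rings are [comPzRingType]s and ideals need not be proper: the zero ring must
   be allowed.  (The [idealr]s of ring_quotient.v are proper by definition.) *)
HB.mixin Record isAbsorbing (A : comPzRingType) (S : A -> bool) := {
  absorbing_subproof : forall a x, x \in (S : {pred A}) -> a * x \in (S : {pred A})
}.

#[short(type="ideal")]
HB.structure Definition Ideal (A : comPzRingType) :=
  {S of GRing.ZmodClosed A S & isAbsorbing A S}.

Section IdealTheory.
Variables (A : comPzRingType) (I : ideal A).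

Lemma ideal0 : 0 \in I. Proof. exact: rpred0. Qed.
Lemma idealD x y : x \in I -> y \in I -> x + y \in I. Proof. exact: rpredD. Qed.
Lemma idealN x : x \in I -> - x \in I. Proof. by rewrite rpredN. Qed.
Lemma idealMl a x : x \in I -> a * x \in I. Proof. exact: absorbing_subproof. Qed.
Lemma idealMr a x : x \in I -> x * a \in I.
Proof. by rewrite mulrC; exact: idealMl. Qed.

End IdealTheory.

Section GeneratedIdeal.
Variables (A : comPzRingType) (X : set A).

Definition gen_pred : A -> bool :=
  fun x => `[< forall J : ideal A, (forall y, X y -> y \in J) -> x \in J >].

Lemma gen_predP x :
  reflect (forall J : ideal A, (forall y, X y -> y \in J) -> x \in J) (x \in gen_pred).
Proof. exact: asboolP. Qed.

Fact gen_zmod_closed : zmod_closed gen_pred.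
Proof.
split; first by apply/gen_predP => J _; exact: ideal0.
move=> x y /gen_predP Hx /gen_predP Hy; apply/gen_predP => J HJ.
by rewrite rpredB ?Hx ?Hy.
Qed.

HB.instance Definition _ := GRing.isZmodClosed.Build A gen_pred gen_zmod_closed.

Fact gen_absorbing a x : x \in gen_pred -> a * x \in gen_pred.
Proof. by move=> /gen_predP Hx; apply/gen_predP => J HJ; rewrite idealMl ?Hx. Qed.

HB.instance Definition _ := isAbsorbing.Build A gen_pred gen_absorbing.

Definition gen : ideal A := Ideal.clone A gen_pred _.

Lemma genP x :
  reflect (forall J : ideal A, (forall y, X y -> y \in J) -> x \in J) (x \in gen).
Proof. exact: asboolP. Qed.

Lemma mem_gen x : X x -> x \in gen.
Proof. by move=> Xx; apply/gen_predP => J; exact. Qed.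

End GeneratedIdeal.

Definition is_generator (A : comPzRingType) (I : ideal A) (x : A) : Prop :=
  I =i gen [set x].

Definition principal (A : comPzRingType) (I : ideal A) : Prop :=
  exists x, is_generator I x.

(* The extended ideal I B, for f : A -> B. *)
Definition ext (A B : comPzRingType) (f : A -> B) (I : ideal A) : ideal B :=
  gen [set f x | x in [set` I]].

Definition idealM (A : comPzRingType) (I J : ideal A) : ideal A :=
  gen [set x * y | x in [set` I] & y in [set` J]].

Definition idealX (A : comPzRingType) (I : ideal A) (n : nat) : ideal A :=
  iter n (idealM I) (gen [set 1]).

Definition maximal (A : comPzRingType) (M : ideal A) : Prop :=
  1 \notin M /\
  forall J : ideal A, {subset M <= J} -> 1 \notin J -> {subset J <= M}.

Definition jacobson (A : comPzRingType) : set A :=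
  [set x | forall M : ideal A, maximal M -> x \in M].

Lemma ideal_of_set (A : comPzRingType) (P : set A) :
  P 0 -> (forall x y, P x -> P y -> P (x + y)) -> (forall a x, P x -> P (a * x)) ->
  exists J : ideal A, forall x, x \in J <-> P x.
Proof.
move=> P0 PD PM; pose J0 : A -> bool := fun x => `[< P x >].
have J0P x : x \in J0 <-> P x by split=> /asboolP.
have J0Z : zmod_closed J0.
  split; first exact/J0P.
  move=> x y /J0P Px /J0P Py; apply/J0P/PD => //.
  by rewrite -mulN1r; exact: PM.
have J0M a x : x \in (J0 : {pred A}) -> a * x \in (J0 : {pred A}).
  by move=> /J0P Px; apply/J0P/PM.
pose m1 := GRing.isZmodClosed.Build A J0 J0Z.
pose m2 := isAbsorbing.Build A J0 J0M.
pose J : ideal A := HB.pack J0 m1 m2.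
by exists J.
Qed.

Lemma gen1P (A : comPzRingType) (c z : A) :
  z \in gen [set c] <-> exists u, z = u * c.
Proof.
split=> [/genP Hz|[u ->]]; last by apply/idealMl/mem_gen.
have [|||J JP] := @ideal_of_set A (fun z => exists u, z = u * c).
- by exists 0; rewrite mul0r.
- by move=> _ _ [u ->] [v ->]; exists (u + v); rewrite mulrDl.
- by move=> a _ [u ->]; exists (a * u); rewrite mulrA.
by apply/JP/Hz => _ ->; apply/JP; exists 1; rewrite mul1r.
Qed.

Lemma jacobson_unit (A : comPzRingType) (x : A) :
  jacobson x -> exists u, u * (1 - x) = 1.
Proof.
move=> xJ; apply: contrapT => Hu.
pose proper (X : set A) := [/\ X 0, (forall y z, X y -> X z -> X (y + z)),
  (forall a y, X y -> X (a * y)), X (1 - x) & ~ X 1].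
pose P (X : set A) := X = set0 \/ proper X.
have nz X : P X -> X !=set0 -> proper X by move=> [->|//] [].
have [F FP Ftot|M [MP Mmax]] := @Zorn_bigcup A P.
  case: (pselect ((\bigcup_(X in F) X) !=set0)) => [[w [X0 FX0 X0w]]|]; last first.
    by move=> /nonemptyPn; left.
  have pX0 : proper X0 by apply: nz (FP _ FX0) _; exists w.
  have [X00 _ _ X0x _] := pX0.
  right; split.
  - by exists X0.
  - move=> y z [X FX Xy] [Y FY Yz].
    have [_ XD _ _ _] : proper X by apply: nz (FP _ FX) _; exists y.
    have [_ YD _ _ _] : proper Y by apply: nz (FP _ FY) _; exists z.
    case: (Ftot _ _ FX FY) => [XY|YX].
      by exists Y => //; apply: YD => //; exact: XY.
    by exists X => //; apply: XD => //; exact: YX.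
  - move=> a y [X FX Xy]; exists X => //.
    by have [_ _ XM _ _] : proper X by [apply: nz (FP _ FX) _; exists y]; exact: XM.
  - by exists X0.
  - move=> [X FX X1].
    by have [_ _ _ _] : proper X by [apply: nz (FP _ FX) _; exists 1].
have pgen : proper [set` gen [set 1 - x]].
  split=> /=; [exact: ideal0|exact: idealD|by move=> *; exact: idealMl| |].
    exact: mem_gen.
  by move=> /gen1P[u Eu]; apply: Hu; exists u.
have [M0 MD MM Mx M1] : proper M.
  case: MP => // M_0; exfalso.
  apply: (Mmax [set` gen [set 1 - x]]); last by right.
  rewrite M_0; split; first exact: sub0set.
  by move=> /(_ 0); apply; exact: ideal0.
have [J JP] := ideal_of_set M0 MD MM.
have Jmax : maximal J.
  split; first by apply/negP => /JP.
  move=> K JK K1 z Kz; apply/JP; apply: contrapT => Mz.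
  apply: (Mmax [set` K]).
    by split=> [y /JP/JK //|/(_ z Kz)].
  right; split=> /=; [exact: ideal0|exact: idealD|by move=> *; exact: idealMl| |].
    exact/JK/JP.
  exact/negP.
apply: M1; rewrite -(subrK x 1); apply: MD => //; apply/JP; exact: xJ.
Qed.

Section Kernel.
Variables (A B : comPzRingType) (f : {rmorphism A -> B}).

Definition ker_pred : A -> bool := fun x => f x == 0.

Fact ker_zmod_closed : zmod_closed ker_pred.
Proof.
split; first by rewrite unfold_in rmorph0.
by move=> x y /eqP Hx /eqP Hy; rewrite unfold_in rmorphB Hx Hy subrr.
Qed.

HB.instance Definition _ := GRing.isZmodClosed.Build A ker_pred ker_zmod_closed.

Fact ker_absorbing a x : x \in ker_pred -> a * x \in ker_pred.
Proof. by move=> /eqP Hx; rewrite unfold_in rmorphM Hx mulr0. Qed.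

HB.instance Definition _ := isAbsorbing.Build A ker_pred ker_absorbing.

Definition ker : ideal A := Ideal.clone A ker_pred _.

Lemma kerP x : reflect (f x = 0) (x \in ker).
Proof. exact: eqP. Qed.

End Kernel.

(* The I-power torsion of B, viewed as a module over A through f. *)
Definition torsion (A B : comPzRingType) (f : {rmorphism A -> B}) (I : ideal A) :
    set B :=
  [set m | forall x, x \in I -> exists2 n, (0 < n)%N & f (x ^+ n) * m = 0].

(* Isomorphism of non-unital rings between subsets closed under + and *. *)
Definition nonunital_iso (A B : comPzRingType) (S : set A) (S' : set B)
    (f : A -> B) : Prop :=
  [/\ set_bij S S' f,
      forall x y, S x -> S y -> f (x + y) = f x + f y &
      forall x y, S x -> S y -> f (x * y) = f x * f y].

(* The additive group of A / I is the library's [Quotient.quot]; the library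
   only makes it a ring when I is proper. *)
Definition rquot (A : comPzRingType) (I : ideal A) : Type := Quotient.quot I.

Section RingQuotient.
Variables (A : comPzRingType) (I : ideal A).
Local Notation Q := (Quotient.quot I).

HB.instance Definition _ := GRing.Zmodule.on (rquot I).

Definition rquot_mul (x y : rquot I) : rquot I :=
  \pi_Q (repr (x : Q) * repr (y : Q)).

Definition qpi (x : A) : rquot I := \pi_Q x.
Definition qrepr (x : rquot I) : A := repr (x : Q).

Lemma qreprK x : qpi (qrepr x) = x. Proof. exact: reprK. Qed.

Lemma qpi_eq x y : (qpi x = qpi y) <-> (x - y \in I).
Proof. by rewrite Quotient.idealrBE; split=> [H|/eqP //]; apply/eqP. Qed.

Lemma qpi_zmod_morphism : zmod_morphism qpi.
Proof. by move=> x y; exact: (raddfB (\pi_Q)). Qed.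

HB.instance Definition _ := GRing.isZmodMorphism.Build A (rquot I) qpi
  qpi_zmod_morphism.

Lemma qpi_mul x y : qpi (x * y) = rquot_mul (qpi x) (qpi y).
Proof.
apply/qpi_eq.
have Hr z : z - qrepr (qpi z) \in I by apply/qpi_eq; rewrite qreprK.
have -> : x * y - qrepr (qpi x) * qrepr (qpi y) =
  (x - qrepr (qpi x)) * y + qrepr (qpi x) * (y - qrepr (qpi y)).
  by rewrite mulrBl mulrBr addrA subrK.
by apply: idealD; [apply: idealMr | apply: idealMl].
Qed.

Fact rquot_mulA : associative rquot_mul.
Proof.
move=> x y z; rewrite -[x]qreprK -[y]qreprK -[z]qreprK.
by rewrite -!qpi_mul mulrA.
Qed.

Fact rquot_mulC : commutative rquot_mul.
Proof. by move=> x y; rewrite -[x]qreprK -[y]qreprK -!qpi_mul mulrC. Qed.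

Fact rquot_mul1 : left_id (qpi 1) rquot_mul.
Proof. by move=> x; rewrite -[x]qreprK -qpi_mul mul1r. Qed.

Fact rquot_mulDl : left_distributive rquot_mul +%R.
Proof.
move=> x y z; rewrite -[x]qreprK -[y]qreprK -[z]qreprK.
by rewrite -raddfD -!qpi_mul mulrDl raddfD.
Qed.

HB.instance Definition _ := GRing.Zmodule_isComPzRing.Build (rquot I)
  rquot_mulA rquot_mulC rquot_mul1 rquot_mulDl.

Fact qpi_monoid_morphism : monoid_morphism qpi.
Proof. by split=> // x y; exact: qpi_mul. Qed.

HB.instance Definition _ := GRing.isMonoidMorphism.Build A (rquot I) qpi
  qpi_monoid_morphism.

Lemma qpi_eq0 x : (qpi x = 0) <-> (x \in I).
Proof. by rewrite -(rmorph0 qpi) qpi_eq subr0. Qed.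

End RingQuotient.

Section QuotientMap.
Variables (A B : comPzRingType) (f : {rmorphism A -> B}).
Variables (I : ideal A) (J : ideal B).
Hypothesis fIJ : forall x, x \in I -> f x \in J.

Definition qmap of (forall x, x \in I -> f x \in J) : rquot I -> rquot J :=
  fun x => qpi J (f (qrepr x)).

Lemma qmapE x : qmap fIJ (qpi I x) = qpi J (f x).
Proof.
by apply/qpi_eq; rewrite -rmorphB; apply: fIJ; apply/qpi_eq; rewrite qreprK.
Qed.

Fact qmap_zmod_morphism : zmod_morphism (qmap fIJ).
Proof.
move=> x y; rewrite -[x]qreprK -[y]qreprK.
by rewrite -raddfB !qmapE !rmorphB.
Qed.

HB.instance Definition _ := GRing.isZmodMorphism.Build (rquot I) (rquot J)
  (qmap fIJ) qmap_zmod_morphism.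

Fact qmap_monoid_morphism : monoid_morphism (qmap fIJ).
Proof.
split; first by rewrite -(rmorph1 (qpi I)) qmapE !rmorph1.
move=> x y; rewrite -[x]qreprK -[y]qreprK.
by rewrite -rmorphM !qmapE !rmorphM.
Qed.

HB.instance Definition _ := GRing.isMonoidMorphism.Build (rquot I) (rquot J)
  (qmap fIJ) qmap_monoid_morphism.

End QuotientMap.

Section Product.
Variable A : nat -> comPzRingType.

Definition dprod : Type := forall i, A i.

HB.instance Definition _ := Choice.copy dprod (forall i, A i).

Definition dprod_zero : dprod := fun i => 0.
Definition dprod_one : dprod := fun i => 1.
Definition dprod_opp (a : dprod) : dprod := fun i => - a i.
Definition dprod_add (a b : dprod) : dprod := fun i => a i + b i.
Definition dprod_mul (a b : dprod) : dprod := fun i => a i * b i.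

Fact dprod_addA : associative dprod_add.
Proof. by move=> a b c; apply: functional_extensionality_dep => i; exact: addrA. Qed.
Fact dprod_addC : commutative dprod_add.
Proof. by move=> a b; apply: functional_extensionality_dep => i; exact: addrC. Qed.
Fact dprod_add0 : left_id dprod_zero dprod_add.
Proof. by move=> a; apply: functional_extensionality_dep => i; exact: add0r. Qed.
Fact dprod_addN : left_inverse dprod_zero dprod_opp dprod_add.
Proof. by move=> a; apply: functional_extensionality_dep => i; exact: addNr. Qed.

HB.instance Definition _ := GRing.isZmodule.Build dprod
  dprod_addA dprod_addC dprod_add0 dprod_addN.

Fact dprod_mulA : associative dprod_mul.
Proof. by move=> a b c; apply: functional_extensionality_dep => i; exact: mulrA. Qed.
Fact dprod_mulC : commutative dprod_mul.
Proof. by move=> a b; apply: functional_extensionality_dep => i; exact: mulrC. Qed.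
Fact dprod_mul1 : left_id dprod_one dprod_mul.
Proof. by move=> a; apply: functional_extensionality_dep => i; exact: mul1r. Qed.
Fact dprod_mulDl : left_distributive dprod_mul +%R.
Proof. by move=> a b c; apply: functional_extensionality_dep => i; exact: mulrDl. Qed.

HB.instance Definition _ := GRing.Zmodule_isComPzRing.Build dprod
  dprod_mulA dprod_mulC dprod_mul1 dprod_mulDl.

End Product.

Section InverseLimit.
Variables (A : nat -> comPzRingType) (f : forall i, {rmorphism A i.+1 -> A i}).

Definition compatible : {pred dprod A} :=
  fun a => `[< forall i, f i (a i.+1) = a i >].

Lemma compatibleP (a : dprod A) :
  reflect (forall i, f i (a i.+1) = a i) (a \in compatible).
Proof. exact: asboolP. Qed.

Record invlim : Type := InvLim {
  seq_of : dprod A;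
  seq_ofP : seq_of \in compatible
}.

HB.instance Definition _ := [isSub for seq_of].
HB.instance Definition _ := [Choice of invlim by <:].

Fact compatible_subring : subring_closed compatible.
Proof.
split; first by apply/compatibleP => i; exact: rmorph1.
  move=> a b /compatibleP Ha /compatibleP Hb; apply/compatibleP => i.
  rewrite -[RHS]/(a i - b i) -Ha -Hb -rmorphB; congr (f i _).
move=> a b /compatibleP Ha /compatibleP Hb; apply/compatibleP => i.
by rewrite -[RHS]/(a i * b i) -Ha -Hb -rmorphM.
Qed.

HB.instance Definition _ := GRing.SubChoice_isSubComPzRing.Build
  (dprod A) compatible invlim compatible_subring.

Definition proj (m : nat) (a : invlim) : A m := seq_of a m.

Lemma projP m a : f m (proj m.+1 a) = proj m a.
Proof. exact: (compatibleP _ (seq_ofP a)). Qed.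

Lemma invlim_ext a b : (forall m, proj m a = proj m b) -> a = b.
Proof.
by move=> H; apply/val_inj/functional_extensionality_dep => m; exact: H.
Qed.

Fact proj_zmod_morphism m : zmod_morphism (proj m).
Proof. by []. Qed.
HB.instance Definition _ m := GRing.isZmodMorphism.Build invlim (A m) (proj m)
  (proj_zmod_morphism m).
Fact proj_monoid_morphism m : monoid_morphism (proj m).
Proof. by []. Qed.
HB.instance Definition _ m := GRing.isMonoidMorphism.Build invlim (A m) (proj m)
  (proj_monoid_morphism m).

End InverseLimit.

Record tower := Tower {
  ring_of :> nat -> comPzRingType;
  trans : forall i, {rmorphism ring_of i -> ring_of i.+1}
}.

Definition shift (T : tower) : tower :=
  @Tower (fun i => T i.+1) (fun i => trans T i.+1).

(* R_0 -> R_i and R_1 -> R_(i+1).  For a pair (R, I_0), the ring R is [T 0]. *)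
Fixpoint from0 (T : tower) (i : nat) : {rmorphism T 0%N -> T i} :=
  if i is i'.+1 then trans T i' \o from0 T i' else idfun.

Definition from1 (T : tower) (i : nat) : {rmorphism T 1%N -> T i.+1} :=
  from0 (shift T) i.

Lemma from0S T i x : from0 T i.+1 x = from1 T i (trans T 0%N x).
Proof.
elim: i => [//|i IHi].
by rewrite -[LHS]/(trans T i.+1 (from0 T i.+1 x)) IHi.
Qed.

Section ReducedTower.
Variables (T : tower) (I0 : ideal (T 0%N)).

Definition ext0 (i : nat) : ideal (T i) := ext (from0 T i) I0.

Definition rbar (i : nat) : comPzRingType := rquot (ext0 i).

Definition pibar (i : nat) : {rmorphism T i -> rbar i} := qpi (ext0 i).

Lemma trans_ext0 i x : x \in ext0 i -> trans T i x \in ext0 i.+1.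
Proof.
move=> /genP Hx; apply/genP => J HJ.
have kerE z : (z \in ker (qpi J \o trans T i)) <-> trans T i z \in J.
  by split=> [/kerP/qpi_eq0 | ?] //; apply/kerP/qpi_eq0.
apply/kerE/Hx => _ [z zI0 <-].
by apply/kerE/HJ; exists z.
Qed.

Definition tbar (i : nat) : {rmorphism rbar i -> rbar i.+1} :=
  qmap (@trans_ext0 i).

End ReducedTower.

Record purely_inseparable (p : nat) (T : tower) (I0 : ideal (T 0%N)) : Prop := {
  pi_pI0 : p%:R \in I0;
  pi_inj : forall i, injective (tbar I0 i);
  pi_frob : forall i,
    range (fun x : rbar I0 i.+1 => x ^+ p) `<=` range (tbar I0 i)
}.

Section FrobeniusProjection.
Variables (p : nat) (p_pr : prime p).

Lemma frobD (A : comPzRingType) (x y : A) :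
  p%:R = 0 :> A -> (x + y) ^+ p = x ^+ p + y ^+ p.
Proof.
move=> pA0; move: pA0 p_pr; case: p => [//|q] pA0 q_pr.
rewrite exprDn big_ord_recl big_ord_recr /= big1 => [|i _ /=].
  by rewrite subn0 subnn bin0 binn !expr0 mulr1 mul1r !mulr1n add0r.
have [] := dvdnP (prime_dvd_bin q_pr (k := bump 0 i) _).
  by rewrite /= ltnS ltn_ord.
by move=> k ->; rewrite -mulr_natr natrM pA0 !mulr0.
Qed.

Variables (T : tower) (I0 : ideal (T 0%N)) (H : purely_inseparable p I0).

Lemma p_rbar i : p%:R = 0 :> rbar I0 i.
Proof.
rewrite -(rmorph_nat (pibar I0 i)); apply/qpi_eq0.
rewrite -(rmorph_nat (from0 T i)); apply: mem_gen.
by exists p%:R => //; exact: pi_pI0 H.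
Qed.

Fact frob_proj_subproof i (x : rbar I0 i.+1) :
  exists y, tbar I0 i y = x ^+ p.
Proof.
by have [y _ yx] := pi_frob H (imageT (fun z : rbar I0 i.+1 => z ^+ p) x); exists y.
Qed.

(* The unique map with tbar (F x) = x ^ p; the primality of p, which makes it
   additive, is an argument so that the ring structure can be inferred. *)
Definition frob_proj (_ : prime p) (i : nat)
    (x : rbar I0 i.+1) : rbar I0 i :=
  projT1 (cid (frob_proj_subproof x)).
Local Notation F := (frob_proj p_pr).

Lemma frob_projP i (x : rbar I0 i.+1) : tbar I0 i (F x) = x ^+ p.
Proof. by rewrite /frob_proj; case: cid. Qed.

Fact frob_proj_zmod_morphism i : zmod_morphism (@frob_proj p_pr i).
Proof.
move=> x y; apply: (pi_inj H).
have E : (x - y) ^+ p + y ^+ p = x ^+ p.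
  by rewrite -(frobD _ _ (p_rbar i.+1)) subrK.
by rewrite rmorphB !frob_projP -E addrK.
Qed.

HB.instance Definition _ i := GRing.isZmodMorphism.Build
  (rbar I0 i.+1) (rbar I0 i) (@frob_proj p_pr i) (@frob_proj_zmod_morphism i).

Fact frob_proj_monoid_morphism i : monoid_morphism (@frob_proj p_pr i).
Proof.
split; first by apply: (pi_inj H); rewrite frob_projP rmorph1 expr1n.
by move=> x y; apply: (pi_inj H); rewrite rmorphM !frob_projP exprMn.
Qed.

HB.instance Definition _ i := GRing.isMonoidMorphism.Build
  (rbar I0 i.+1) (rbar I0 i) (@frob_proj p_pr i) (@frob_proj_monoid_morphism i).

Lemma frob_proj_tbar i (x : rbar I0 i.+1) : F (tbar I0 i.+1 x) = tbar I0 i (F x).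
Proof. by apply: (pi_inj H); rewrite !frob_projP rmorphXn. Qed.

End FrobeniusProjection.

Section Cast.
Variable A : nat -> comPzRingType.

Definition rcast (m n : nat) (e : m = n) : {rmorphism A m -> A n} :=
  match e with erefl => idfun end.

End Cast.

Section Tilt.
Variables (p : nat) (p_pr : prime p).
Variables (T : tower) (I0 : ideal (T 0%N)) (H : purely_inseparable p I0).

(* Indices are written m + j, not j + m, so that m.+1 + j is (m + j).+1 by
   computation. *)
Definition tilt_map (j m : nat) : {rmorphism rbar I0 (m.+1 + j) -> rbar I0 (m + j)} :=
  @frob_proj p T I0 H p_pr (m + j).

Definition tilt_ring (j : nat) : comPzRingType :=
  @invlim (fun m => rbar I0 (m + j)) (tilt_map j).

(* tbar lands in the index (m + j).+1, only propositionally equal to m + j.+1. *)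
Definition tilt_trans_seq (j : nat) (a : tilt_ring j) :
    dprod (fun m => rbar I0 (m + j.+1)) :=
  fun m => rcast (rbar I0) (esym (addnS m j)) (tbar I0 (m + j) (proj m a)).

Lemma frob_proj_rcast m n (e : m = n) (e' : m.+1 = n.+1) (x : rbar I0 m.+1) :
  frob_proj H p_pr (rcast (rbar I0) e' x) =
  rcast (rbar I0) e (frob_proj H p_pr x).
Proof. by case: _ / e in e' *; rewrite (eq_irrelevance e' erefl). Qed.

Fact tilt_trans_subproof j (a : tilt_ring j) :
  tilt_trans_seq a \in
    @compatible (fun m => rbar I0 (m + j.+1)) (tilt_map j.+1).
Proof.
apply/compatibleP => m; rewrite /tilt_trans_seq.
rewrite -[in RHS](projP m a) -frob_proj_tbar.
exact: frob_proj_rcast.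
Qed.

Definition tilt_trans (j : nat) (a : tilt_ring j) : tilt_ring j.+1 :=
  InvLim (tilt_trans_subproof a).

Lemma proj_tilt_trans j m a : proj m (@tilt_trans j a) =
  rcast (rbar I0) (esym (addnS m j)) (tbar I0 (m + j) (proj m a)).
Proof. by []. Qed.

Fact tilt_trans_zmod_morphism j : zmod_morphism (@tilt_trans j).
Proof.
by move=> a b; apply: invlim_ext => m; rewrite rmorphB !proj_tilt_trans !rmorphB.
Qed.

HB.instance Definition _ j := GRing.isZmodMorphism.Build
  (tilt_ring j) (tilt_ring j.+1) (@tilt_trans j) (@tilt_trans_zmod_morphism j).

Fact tilt_trans_monoid_morphism j : monoid_morphism (@tilt_trans j).
Proof.
split; first by apply: invlim_ext => m; rewrite proj_tilt_trans !rmorph1.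
by move=> a b; apply: invlim_ext => m; rewrite rmorphM !proj_tilt_trans !rmorphM.
Qed.

HB.instance Definition _ j := GRing.isMonoidMorphism.Build
  (tilt_ring j) (tilt_ring j.+1) (@tilt_trans j) (@tilt_trans_monoid_morphism j).

Definition tilt : tower := @Tower tilt_ring (fun j => @tilt_trans j).

Definition Phi (j m : nat) : {rmorphism tilt j -> rbar I0 (m + j)} := @proj _ _ m.

End Tilt.

(* (R_i)_{I_0-tor} *)
Definition tor (T : tower) (I0 : ideal (T 0%N)) (i : nat) : set (T i) :=
  torsion (from0 T i) I0.
Arguments tor {T} I0 i _.

Section Pillars.
Variables (p : nat) (p_pr : prime p) (T : tower) (I0 : ideal (T 0%N)).

Record first_pillar (H : purely_inseparable p I0) (I1 : ideal (T 1%N)) : Prop := {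
  fp_principal : principal I1;
  fp_pow : idealX I1 p =i ext0 I0 1;
  fp_ker : forall i, ker (@frob_proj p T I0 H p_pr i) =i
                     ext (pibar I0 i.+1 \o from1 T i) I1
}.

Record perfectoid_tower : Prop := {
  pt_pi : purely_inseparable p I0;
  pt_surj : forall i y, exists x, @frob_proj p T I0 pt_pi p_pr i x = y;
  pt_jac : forall i, [set` ext0 I0 i] `<=` @jacobson (T i);
  pt_principal : principal I0;
  pt_I1 : exists I1, first_pillar pt_pi I1;
  pt_tor0 : forall i (x : T 0%N) (m : T i), x \in I0 -> tor I0 i m -> from0 T i x * m = 0;
  pt_tor : forall i, exists f : T i.+1 -> T i,
    set_bij (tor I0 i.+1) (tor I0 i) f /\
    forall m : T i.+1, tor I0 i.+1 m ->
      pibar I0 i (f m) = frob_proj pt_pi p_pr (pibar I0 i.+1 m)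
}.

Record pillars (HT : perfectoid_tower) (I : forall i, ideal (T i)) : Prop := {
  pl_0 : I 0%N =i I0;
  pl_1 : first_pillar (pt_pi HT) (I 1%N);
  pl_principal : forall i, principal (I i);
  pl_preim : forall i x,
    (frob_proj (pt_pi HT) p_pr x \in ext (pibar I0 i) (I i)) =
    (x \in ext (pibar I0 i.+1) (I i.+1))
}.


Section PillarTheory.
Variables (HT : perfectoid_tower) (I : forall i, ideal (T i)) (HI : pillars HT I).

Lemma ext0_pillar i x : x \in ext0 I0 i -> x \in I i.
Proof.
case: i x => [|j] x.
  by move=> /genP; apply=> _ [z zI0 <-]; rewrite (pl_0 HI).
have [pI1 powI1 kerI1] := pl_1 HI; have [f f_gen] := pI1.
have fI : f \in I 1%N by rewrite f_gen; apply: mem_gen.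
pose g : T j.+1 := from1 T j f.
have sqr z : z \in ext0 I0 j.+1 -> exists r, z = r * (g * g).
  move=> /genP Hz; apply/gen1P/Hz => _ [y yI0 <-]; rewrite from0S.
  have : trans T 0%N y \in ext0 I0 1%N by apply: mem_gen; exists y.
  rewrite -powI1; move: (p_pr); case: (p) => [|[|q]] // _ /genP Hy.
  suff /gen1P[r ->] : trans T 0%N y \in gen [set f * f].
    by apply/gen1P; exists (from1 T j r); rewrite !rmorphM.
  apply: Hy => _ [a aI [b /= bI <-]]; apply/gen1P.
  have /gen1P[u ->] : a \in gen [set f] by rewrite -f_gen.
  have /gen1P[v ->] : b \in gen [set f].
    rewrite -f_gen; move: bI => /genP; apply=> _ [c cI [d _ <-]].
    exact: idealMr.
  by exists (u * v); rewrite mulrACA.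
have gp_jac r : jacobson ((r * g) ^+ p).
  apply: (pt_jac HT); rewrite /= exprMn; apply: idealMl.
  have fp : f ^+ p \in ext0 I0 1.
    rewrite -powI1; elim: (p) => [|n IHn]; first exact: mem_gen.
    by apply: mem_gen; exists f => //; exists (f ^+ n); rewrite ?exprS.
  rewrite -rmorphXn; apply/qpi_eq0.
  apply/(kerP (qpi (ext0 I0 j.+1) \o from1 T j)).
  move: fp => /genP; apply=> _ [z zI0 <-]; apply/kerP/qpi_eq0.
  by rewrite -[from0 T 1%N z]/(trans T 0%N z) -from0S; apply: mem_gen; exists z.
have [a aI /qpi_eq ga] : exists2 a, a \in I j.+1 & pibar I0 j.+1 g = pibar I0 j.+1 a.
  have : pibar I0 j.+1 g \in ext (pibar I0 j.+1) (I j.+1).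
    rewrite -(pl_preim HI).
    have : pibar I0 j.+1 g \in ker (@frob_proj p T I0 (pt_pi HT) p_pr j).
      by rewrite kerI1; apply: mem_gen; exists f.
    by move=> /kerP ->; exact: ideal0.
  have [|||J JP] := @ideal_of_set (rbar I0 j.+1)
      (fun z => exists2 a, a \in I j.+1 & z = pibar I0 j.+1 a).
  - by exists 0; [exact: ideal0|rewrite rmorph0].
  - move=> _ _ [u uI ->] [v vI ->]; exists (u + v); last by rewrite rmorphD.
    exact: idealD.
  - move=> c _ [u uI ->]; exists (qrepr c * u); first exact: idealMl.
    by rewrite rmorphM -[in LHS](qreprK c).
  by move=> /genP Hg; apply/JP/Hg => _ [u uI <-]; apply/JP; exists u.
have [r Er] := sqr _ ga.
have ag : g * (1 - r * g) = a.
  by rewrite mulrBr mulr1 mulrCA -Er opprB addrCA subrr addr0.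
have [u Eu] := jacobson_unit (gp_jac r).
have gI : g \in I j.+1.
  rewrite -[g]mulr1 -Eu -opprB subrX1 -mulNr opprB [u * _]mulrC mulrA mulrA ag.
  by do 2!apply: idealMr.
by move=> /sqr[z ->]; do 2!apply: idealMl.
Qed.

(* R_j / I_0 R_j ->> R_j / I_j *)
Definition pillar_proj (j : nat) : {rmorphism rbar I0 j -> rquot (I j)} :=
  @qmap _ _ idfun _ _ (@ext0_pillar j).

(* I_j^{s.flat} *)
Definition tilt_pillar (j : nat) : ideal (tilt p_pr (pt_pi HT) j) :=
  ker (pillar_proj j \o Phi p_pr (pt_pi HT) j 0%N).

End PillarTheory.

End Pillars.

(* Main.v *)
(* Write J_k for the image of I_k in R_k / I_0. It is the preimage of 0 under
   F_0 ... F_(k-1), hence nilpotent, and by the bijections (F_i)_tor it kills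
   (R_k)_tor.  If g in R_(k+1) divides a generator c of I_1 R_(k+1), then, I_0 R_(k+1)
   being generated by c ^ p with p > 1, the annihilator of g in R_(k+1) / I_0 is
   mapped by F_k into the image of the torsion.  In (1), an element of I_j^flat is
   divided by f level by level; the quotients are compatible only up to such
   annihilators, and a torsion correction followed by one application of the Frobenius
   projections makes them compatible.  The equality of ideals holds because t_j^flat
   composed with the shift R_(j+1)^flat -> R_j^flat is the Frobenius.  In (2), the tilt
   is reduced, so its torsion is the annihilator of a generator of I_0^flat; by the
   same principle it consists of the sequences of torsion elements, which the
   bijections (F_i)_tor identify with their 0-th term. *)
Require Import Defs.
From mathcomp Require Import all_boot all_order all_algebra.
From mathcomp Require Import boolp classical_sets functions.

Set Implicit Arguments.
Unset Strict Implicit.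
Unset Printing Implicit Defensive.

Import GRing.Theory.
Local Open Scope ring_scope.
Local Open Scope classical_set_scope.

(** * Dependent choice, principal ideals and their powers *)

(** Serves to build elements of inverse limits one coordinate at a time: [P] is the invariant of
    each term, [Q] links consecutive terms. *)
Lemma dependent_choice_seq (A : nat -> Type) (P : forall i, A i -> Prop)
    (Q : forall i, A i -> A i.+1 -> Prop) (x0 : A 0%N) :
  P 0%N x0 -> (forall i x, P i x -> exists y, P i.+1 y /\ Q i x y) ->
  exists s : forall i, A i,
    s 0%N = x0 /\ forall i, P i (s i) /\ Q i (s i) (s i.+1).
Proof.
move=> Px0 step.
have step' i (x : {x | P i x}) : {y : {y | P i.+1 y} | Q i (sval x) (sval y)}.
  by apply: cid; case: x => x Px; have [y [Py Qxy]] := step i x Px; exists (exist _ y Py).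
pose s := fix s i : {x | P i x} :=
  if i is i'.+1 then sval (step' i' (s i')) else exist _ x0 Px0.
exists (fun i => sval (s i)); split=> // i; split; first exact: (svalP (s i)).
exact: (svalP (step' i (s i))).
Qed.

Lemma generatorP (A : comPzRingType) (I : ideal A) (x : A) :
  is_generator I x <-> forall z, z \in I <-> exists u, z = u * x.
Proof.
split=> [Ix z|Ix z]; first by rewrite Ix; exact: gen1P.
by apply/idP/idP => [/Ix/gen1P //|/gen1P/Ix].
Qed.

Lemma mem_generator (A : comPzRingType) (I : ideal A) (x : A) :
  is_generator I x -> x \in I.
Proof. by move=> ->; exact: mem_gen. Qed.

Lemma ext_mem (A B : comPzRingType) (f : A -> B) (I : ideal A) x :
  x \in I -> f x \in ext f I.
Proof. by move=> xI; apply: mem_gen; exists x. Qed.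

Lemma ext_generator (A B : comPzRingType) (f : {rmorphism A -> B}) (I : ideal A) x :
  is_generator I x -> is_generator (ext f I) (f x).
Proof.
move=> /generatorP Ix; apply/generatorP => z; split=> [/genP Hz|[u ->]].
  apply/gen1P/Hz => _ [y /Ix[u ->] <-]; apply/gen1P.
  by exists (f u); rewrite rmorphM.
by apply/idealMl/ext_mem/Ix; exists 1; rewrite mul1r.
Qed.

Lemma idealX_generator (A : comPzRingType) (I : ideal A) x n :
  is_generator I x -> is_generator (idealX I n) (x ^+ n).
Proof.
move=> Ix; have xI := mem_generator Ix; move/generatorP: Ix => Ix.
elim: n => [//|n /generatorP IHn]; apply/generatorP => z; split=> [/genP Hz|[u ->]].
  apply/gen1P/Hz => _ [a /= /Ix[u ->] [b /IHn[v ->] <-]]; apply/gen1P.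
  by exists (u * v); rewrite exprS mulrACA.
apply/idealMl/mem_gen; exists x => //; exists (x ^+ n); last by rewrite exprS.
by apply/IHn; exists 1; rewrite mul1r.
Qed.

Lemma nilpotent_sub1_unit (A : comPzRingType) (e : A) n :
  e ^+ n = 0 -> exists v, v * (1 - e) = 1.
Proof.
move=> en; exists (\sum_(i < n) e ^+ i).
by rewrite mulrC -opprB mulNr -subrX1 en sub0r opprK.
Qed.

Lemma expr0_prime_pred (A : comPzRingType) q : prime q -> 0 ^+ q.-1 = 0 :> A.
Proof. by move/prime_gt1; case: q => [|[|q]] // _; rewrite expr0n. Qed.

(** * Inverse limits along surjections *)

Section SurjectiveLimit.
Variables (A : nat -> comPzRingType) (f : forall i, {rmorphism A i.+1 -> A i}).

Definition compatible_lim (a : forall i, A i) (Ha : forall i, f i (a i.+1) = a i) :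
  invlim f := InvLim (introT (compatibleP f a) Ha).

End SurjectiveLimit.

(** For [m = 0], preimages are chosen successively. The step applies induction to the shifted system
    and adds a bottom coordinate by means of [f 0]. *)
Lemma proj_surj (A : nat -> comPzRingType) (f : forall i, {rmorphism A i.+1 -> A i}) :
  (forall i y, exists x, f i x = y) ->
  forall m y, exists a : invlim f, proj m a = y.
Proof.
move=> f_surj m; elim: m A f f_surj => [|m IHm] A f f_surj y.
  have [||s [<- Hs]] := @dependent_choice_seq A (fun _ _ => True)
    (fun i x z => f i z = x) y => //.
    by move=> i x _; have [z <-] := f_surj i x; exists z.
  by exists (compatible_lim (fun i => (Hs i).2)).
have [a <-] := IHm _ (fun i => f i.+1) (fun i => f_surj i.+1) y.
pose b i : A i := if i is i'.+1 then proj i' a else f 0%N (proj 0%N a).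
have Hb i : f i (b i.+1) = b i by case: i => [//|i]; exact: projP.
by exists (compatible_lim Hb).
Qed.

(** * Torsion in a tower *)

Section TowerTorsion.
Variables (T : tower) (I0 : ideal (T 0%N)).

Lemma torD i m n : tor I0 i m -> tor I0 i n -> tor I0 i (m + n).
Proof.
move=> Hm Hn x xI; have [a a_gt0 Ea] := Hm x xI; have [b b_gt0 Eb] := Hn x xI.
exists (a + b)%N; first by rewrite addn_gt0 a_gt0.
rewrite mulrDr {1}[(a + b)%N]addnC !exprD !rmorphM -!mulrA Ea Eb.
by rewrite !mulr0 addr0.
Qed.

Lemma torMl i a m : tor I0 i m -> tor I0 i (a * m).
Proof.
by move=> Hm x xI; have [n n_gt0 En] := Hm x xI; exists n; rewrite // mulrCA En mulr0.
Qed.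

Lemma torB i m n : tor I0 i m -> tor I0 i n -> tor I0 i (m - n).
Proof. by move=> Hm Hn; apply: torD => //; rewrite -mulN1r; exact: torMl. Qed.

Lemma tor_trans i m : tor I0 i m -> tor I0 i.+1 (trans T i m).
Proof.
move=> Hm x xI; have [n n_gt0 En] := Hm x xI; exists n => //.
by rewrite -[from0 T i.+1 _]/(trans T i (from0 T i (x ^+ n))) -rmorphM En rmorph0.
Qed.

End TowerTorsion.

(** * Torsion under reduction and under the Frobenius projections *)

Section PerfectoidTower.
Variables (p : nat) (p_pr : prime p) (T : tower) (I0 : ideal (T 0%N)).
Variable HT : perfectoid_tower p_pr I0.

Local Notation H := (pt_pi HT).
Local Notation F := (frob_proj H p_pr).
Local Notation bar i := (pibar I0 i).

Lemma bar_repr i (x : rbar I0 i) : bar i (qrepr x) = x.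
Proof. exact: qreprK. Qed.

Lemma tbar_bar i x : tbar I0 i (bar i x) = bar i.+1 (trans T i x).
Proof. exact: qmapE. Qed.

Lemma bar_eq0 i x : bar i x = 0 <-> x \in ext0 I0 i.
Proof. exact: qpi_eq0. Qed.

(** [I_0 R_i] lies in the Jacobson radical, so a product congruent to 1 is a unit. *)
Lemma bar_unit i (x : T i) :
  (exists u, u * bar i x = 1) -> exists v, v * x = 1.
Proof.
move=> [u]; rewrite -[u]bar_repr -rmorphM -(rmorph1 (bar i)).
move=> /qpi_eq Hx; have := jacobson_unit (pt_jac HT (idealN Hx)).
by move=> [v]; rewrite opprK addrC subrK mulrA => Ev; exists (v * qrepr u).
Qed.

Lemma torE i m : tor I0 i m <-> forall x, x \in I0 -> from0 T i x * m = 0.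
Proof.
split=> [Hm x xI|Hm x xI]; first exact: (pt_tor0 HT).
by exists 1%N; rewrite // expr1 Hm.
Qed.

(** Write [m = u * f] with [f] generating [I_0 R_i]. Torsion gives [f ^ 2 * u = f * m = 0], so [u]
    is itself torsion and [f] kills it. *)
Lemma tor_bar_eq0 i m : tor I0 i m -> bar i m = 0 -> m = 0.
Proof.
move=> Hm /bar_eq0; have [f f_gen] := pt_principal HT.
have /generatorP fP := ext_generator (from0 T i) f_gen.
move=> /fP[u mE]; rewrite mE mulrC; apply: (pt_tor0 HT) (mem_generator f_gen) _.
move=> x xI; exists 2%N => //.
have [c ->] : exists c, x = c * f by have /generatorP fI := f_gen; exact/fI.
rewrite rmorphXn rmorphM exprMn -mulrA [from0 T i f ^+ 2]expr2 -[_ * _ * u]mulrA.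
by rewrite [from0 T i f * u]mulrC -mE (pt_tor0 HT (mem_generator f_gen) Hm) !mulr0.
Qed.

Lemma tor_bar_inj i m n : tor I0 i m -> tor I0 i n -> bar i m = bar i n -> m = n.
Proof.
move=> Hm Hn E; apply/eqP; rewrite -subr_eq0; apply/eqP/(@tor_bar_eq0 i).
  exact: torB.
by rewrite rmorphB E subrr.
Qed.

Lemma tor_frob i t : tor I0 i.+1 t -> exists2 s, tor I0 i s & F (bar i.+1 t) = bar i s.
Proof.
move=> Ht; have [f [[fS _ _] fE]] := pt_tor HT i.
by exists (f t); [exact: fS|rewrite fE].
Qed.

Lemma tor_frob_surj i s :
  tor I0 i s -> exists2 t, tor I0 i.+1 t & F (bar i.+1 t) = bar i s.
Proof.
move=> Hs; have [f [[_ _ fsurj] fE]] := pt_tor HT i.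
by have [t Ht <-] := fsurj _ Hs; exists t => //; rewrite fE.
Qed.

Lemma tor_frob_eq0 i t : tor I0 i.+1 t -> F (bar i.+1 t) = 0 -> t = 0.
Proof.
move=> Ht Ft; have [f [[fS finj _] fE]] := pt_tor HT i.
have t0 : tor I0 i.+1 0 by apply/torE => x _; rewrite mulr0.
apply: finj; rewrite ?inE //; apply: tor_bar_inj; [exact: fS|exact: fS|].
by rewrite !fE // Ft !rmorph0.
Qed.

(* The Frobenius projection is injective on torsion. *)
Lemma tor_mul_eq0 i (x : rbar I0 i.+1) t :
  tor I0 i.+1 t -> F x * F (bar i.+1 t) = 0 -> x * bar i.+1 t = 0.
Proof.
rewrite -[x]bar_repr -!rmorphM => Ht E.
by rewrite (tor_frob_eq0 (torMl _ Ht) E) rmorph0.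
Qed.

End PerfectoidTower.

(** * Pillars modulo [I_0]: nilpotence, annihilators, generators *)

Section Pillars.
Variables (p : nat) (p_pr : prime p) (T : tower) (I0 : ideal (T 0%N)).
Variables (HT : perfectoid_tower p_pr I0) (I : forall i, ideal (T i)).
Variable HI : pillars HT I.

Local Notation H := (pt_pi HT).
Local Notation F := (frob_proj H p_pr).
Local Notation bar i := (pibar I0 i).
Local Notation J k := (ext (bar k) (I k)).

Lemma pillar_bar0 (x : rbar I0 0) : x \in J 0%N -> x = 0.
Proof.
move=> /genP Hx; apply/(kerP (idfun : {rmorphism rbar I0 0 -> rbar I0 0}))/Hx.
move=> _ [y /= yI <-]; apply/kerP/bar_eq0.
by apply: mem_gen; exists y => //; rewrite /= -(pl_0 HI).
Qed.

Lemma pillar_frob k (x : rbar I0 k.+1) : (F x \in J k) = (x \in J k.+1).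
Proof. exact: (pl_preim HI). Qed.

Lemma pillar_bar_principal k : principal (J k).
Proof. by have [g Ig] := pl_principal HI k; exists (bar k g); exact: ext_generator. Qed.

Lemma pillar_proj_eq0 k (x : rbar I0 k) : pillar_proj HI k x = 0 <-> x \in J k.
Proof.
split=> [|/genP Hx].
  rewrite -[x]bar_repr /pillar_proj [LHS]qmapE => /qpi_eq0 /=.
  exact: ext_mem.
apply/kerP/Hx => _ [y yI <-]; apply/kerP.
by rewrite /pillar_proj [LHS]qmapE; exact/qpi_eq0.
Qed.

(** Induction through [x ^ p = tbar (F x)], starting from [J 0 = 0]. *)
Lemma pillar_nilpotent k (x : rbar I0 k) : x \in J k -> exists n, x ^+ n = 0.
Proof.
elim: k x => [|k IHk] x; first by move=> /pillar_bar0 ->; exists 1%N.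
rewrite -pillar_frob => /IHk[n xn0]; exists (p * n)%N.
by rewrite exprM -(frob_projP p_pr H) -rmorphXn xn0 rmorph0.
Qed.

(** By induction [F x] kills the image of [t] one level below, and [F] is injective on torsion. *)
Lemma pillar_tor k (x : rbar I0 k) t : tor I0 k t -> x \in J k -> x * bar k t = 0.
Proof.
elim: k x t => [|k IHk] x t Ht; first by move=> /pillar_bar0 ->; rewrite mul0r.
rewrite -pillar_frob => Fx; have [s Hs Es] := tor_frob HT Ht.
by apply: (tor_mul_eq0 (HT := HT)); rewrite // Es IHk.
Qed.

(* A generator of [I_1 R_(k+1)]: its class generates [ker F_k], and its p-th power
   generates [I_0 R_(k+1)]. *)
Definition ker_gen k : T k.+1 := from1 T k (sval (cid (pl_principal HI 1))).
Local Notation gam := ker_gen.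

Lemma ker_genS k : gam k.+1 = trans T k.+1 (gam k).
Proof. by []. Qed.

Lemma ker_frob k (x : rbar I0 k.+1) : F x = 0 <-> exists u, x = u * bar k.+1 (gam k).
Proof.
rewrite /ker_gen; case: cid => g /= g_gen.
have [_ _ kerE] := pl_1 HI.
have /generatorP <- := ext_generator (bar k.+1 \o from1 T k) g_gen.
by rewrite -kerE; split=> [|/kerP //]; move/kerP.
Qed.

Lemma frob_ker_gen k : F (bar k.+1 (gam k)) = 0.
Proof. by apply/ker_frob; exists 1; rewrite mul1r. Qed.

Lemma ker_gen_pillar k : bar k.+1 (gam k) \in J k.+1.
Proof. by rewrite -pillar_frob frob_ker_gen ideal0. Qed.

Lemma ext0_ker_gen k z : z \in ext0 I0 k.+1 -> exists u, z = u * gam k ^+ p.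
Proof.
rewrite /ker_gen; case: cid => g /= g_gen.
have [_ powE _] := pl_1 HI.
move=> /genP Hz; apply/gen1P/Hz => _ [y yI <-].
rewrite -[trans T k _]/(from0 T k.+1 y) from0S.
have /generatorP gp := idealX_generator p g_gen.
have : trans T 0%N y \in ext0 I0 1 by apply: (ext_mem (from0 T 1)).
by rewrite -powE => /gp[u ->]; apply/gen1P; exists (from1 T k u); rewrite rmorphM rmorphXn.
Qed.

Lemma tor_ker_gen k t : gam k * t = 0 -> tor I0 k.+1 t.
Proof.
move=> gt0; apply/(torE HT) => x xI.
have [u ->] : exists u, from0 T k.+1 x = u * gam k ^+ p.
  by apply: ext0_ker_gen; apply: ext_mem.
by rewrite -(prednK (prime_gt0 p_pr)) exprSr -!mulrA gt0 !mulr0.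
Qed.

(** The congruence modulo [gam k ^ p] reads [(1 - e) * gam k = c * g] with [e] a multiple of
    [gam k ^ p.-1], and [1 - e] is a unit. *)
Lemma ker_gen_dvd_lift k (g c : T k.+1) :
  bar k.+1 (gam k) = bar k.+1 (c * g) -> exists c', gam k = c' * g.
Proof.
move=> /qpi_eq/ext0_ker_gen[u Eu].
pose e := u * gam k ^+ p.-1.
have gE : (1 - e) * gam k = c * g.
  rewrite mulrBl mul1r /e -mulrA -exprSr prednK ?prime_gt0 // -Eu.
  by rewrite opprB addrC subrK.
have [|v Ev] := @bar_unit _ _ _ _ HT _ (1 - e).
  (* The [p]-th power of the class of [1 - e] is [tbar (F (1 - e)) = 1], because [F] kills [gam k]
     and [p.-1 > 0]. *)
  exists (bar k.+1 (1 - e) ^+ p.-1); rewrite -exprSr prednK ?prime_gt0 //.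
  rewrite -(frob_projP p_pr H) /e !(rmorphB, rmorph1, rmorphM, rmorphXn) /= frob_ker_gen.
  by rewrite rmorph0 expr0_prime_pred // mulr0 subr0.
by exists (v * c); rewrite -mulrA -gE mulrA Ev mul1r.
Qed.

(** On lifts, [y' * g' = u * gam k ^ p] and [gam k = d * g']. Subtracting a suitable multiple of
    [gam k ^ p.-1] from [y'] gives an element that kills [g'], hence [gam k], so it is torsion; [F]
    does not see the subtracted term. *)
Lemma frob_annihilator k (g y : rbar I0 k.+1) :
  (exists c, bar k.+1 (gam k) = c * g) -> y * g = 0 ->
  exists2 t, tor I0 k.+1 t & F y = F (bar k.+1 t).
Proof.
move=> [c]; rewrite -[c]bar_repr -[g]bar_repr -[y]bar_repr -!rmorphM.
set y' := qrepr y; set g' := qrepr g.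
move=> /ker_gen_dvd_lift[d Ed] /bar_eq0/ext0_ker_gen[u Eu].
have pE : gam k ^+ p = gam k ^+ p.-1 * d * g'.
  by rewrite -{1}(prednK (prime_gt0 p_pr)) exprSr {2}Ed mulrA.
exists (y' - u * (gam k ^+ p.-1 * d)).
  apply: tor_ker_gen; rewrite {1}Ed -mulrA [g' * _]mulrC mulrBl.
  by rewrite -[_ * _ * g']mulrA -pE Eu subrr mulr0.
rewrite !(rmorphB, rmorphM, rmorphXn) /= frob_ker_gen.
by rewrite expr0_prime_pred // mul0r mulr0 subr0.
Qed.

Lemma frob_surj k (y : rbar I0 k) : exists x, F x = y.
Proof. exact: (pt_surj HT). Qed.

Lemma generator_frob k (y : rbar I0 k.+1) :
  is_generator (J k.+1) y -> is_generator (J k) (F y).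
Proof.
move=> /generatorP Jy; apply/generatorP => z; split=> [|[u ->]].
  have [w <-] := frob_surj z; rewrite pillar_frob => /Jy[u ->].
  by exists (F u); rewrite rmorphM.
by apply: idealMl; rewrite pillar_frob; apply/Jy; exists 1; rewrite mul1r.
Qed.

(* The kernel generator is [z ^+ p] for some [z] in the nilpotent ideal [J k.+2],
   so it is absorbed by Nakayama's argument. *)
Lemma frob_generator k (y : rbar I0 k.+2) :
  is_generator (J k.+1) (F y) -> is_generator (J k.+2) y.
Proof.
move=> Fy; have yJ : y \in J k.+2 by rewrite -pillar_frob; exact: mem_generator.
move/generatorP: Fy => Fy.
have [g g_gen] := pillar_bar_principal k.+2; have gJ := mem_generator g_gen.
move/generatorP: g_gen => g_gen.
have [v Ev] : exists v, F g = v * F y by apply/Fy; rewrite pillar_frob.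
have [v' Ev'] := frob_surj v.
have /ker_frob[w Ew] : F (g - v' * y) = 0 by rewrite rmorphB rmorphM /= Ev' Ev subrr.
have [z Ez] := frob_surj (bar k.+1 (gam k)).
have [c Ec] : exists c, z = c * g.
  by apply/g_gen; rewrite -pillar_frob Ez; exact: ker_gen_pillar.
pose e := w * c ^+ p * g ^+ p.-1.
have eg : e * g = w * z ^+ p.
  by rewrite Ec exprMn mulrA /e -[LHS]mulrA -exprSr prednK ?prime_gt0.
have eE : (1 - e) * g = v' * y.
  rewrite mulrBl mul1r eg -(frob_projP p_pr H) Ez tbar_bar -ker_genS -Ew.
  by rewrite opprB addrC subrK.
have [n en0] : exists n, e ^+ n = 0.
  apply: (@pillar_nilpotent k.+2); rewrite /e.
  rewrite -[p.-1]prednK ?ltn_predRL ?prime_gt1 // exprSr.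
  by do 2!apply: idealMl.
have [u Eu] := nilpotent_sub1_unit en0.
apply/generatorP => x; split=> [/g_gen[a ->]|[a ->]]; last exact: idealMl.
by exists (a * (u * v')); rewrite -!mulrA -eE [u * _]mulrA Eu mul1r.
Qed.

End Pillars.

(** * Generators and powers of the pillars of the tilt *)

Section TiltPillars.
Variables (p : nat) (p_pr : prime p) (T : tower) (I0 : ideal (T 0%N)).
Variables (HT : perfectoid_tower p_pr I0) (I : forall i, ideal (T i)).
Variable HI : pillars HT I.

Local Notation H := (pt_pi HT).
Local Notation F := (frob_proj H p_pr).
Local Notation bar i := (pibar I0 i).
Local Notation J k := (ext (bar k) (I k)).
Local Notation T' := (tilt p_pr H).
Local Notation P := (Phi p_pr H).
Local Notation I' := (tilt_pillar HI).
Local Notation rc e := (rcast (rbar I0) e).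

Lemma Phi_frob j m (a : T' j) : F (P j m.+1 a) = P j m a.
Proof. exact: projP m a. Qed.

Lemma tilt_ext j (a b : T' j) : (forall m, P j m a = P j m b) -> a = b.
Proof. exact: invlim_ext. Qed.

Lemma tilt_mk j (a : forall m, rbar I0 (m + j)) :
  (forall m, F (a m.+1) = a m) -> exists b : T' j, forall m, P j m b = a m.
Proof. by move=> Ha; exists (@compatible_lim _ (tilt_map p_pr H j) a Ha). Qed.

Lemma Phi_surj j m (y : rbar I0 (m + j)) : exists a : T' j, P j m a = y.
Proof. by apply: proj_surj => i z; exact: (frob_surj HT). Qed.

Lemma Phi_trans j m (a : T' j) :
  P j.+1 m (trans T' j a) = rc (esym (addnS m j)) (tbar I0 (m + j) (P j m a)).
Proof. by []. Qed.

Lemma tilt_pillar_Phi j m (a : T' j) : (a \in I' j) <-> (P j m a \in J (m + j)%N).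
Proof.
elim: m => [|m IHm].
  by rewrite -(pillar_proj_eq0 HI) /=; split=> [/kerP //|E]; apply/kerP.
by rewrite IHm -(Phi_frob m) (pillar_frob HI).
Qed.

Lemma Phi_generator j m (f : T' j) :
  is_generator (I' j) f -> is_generator (J (m + j)%N) (P j m f).
Proof.
move=> f_gen; have fI := mem_generator f_gen; move/generatorP: f_gen => f_gen.
apply/generatorP => z; split=> [|[u ->]]; last first.
  by apply: idealMl; exact/tilt_pillar_Phi.
have [a <-] := Phi_surj z; move=> /tilt_pillar_Phi/f_gen[u ->].
by exists (P j m u); rewrite rmorphM.
Qed.

(* The quotients [x m] of [a] by [f] at each level are determined up to the
   annihilator of [f], which the Frobenius projection maps into the torsion;
   correcting [x m.+1] by torsion makes the sequence [F (x m)] compatible. *)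
Lemma Phi_dvd j (f a : T' j) :
  (forall m, is_generator (J (m + j)%N) (P j m f)) -> a \in I' j ->
  exists u, a = u * f.
Proof.
move=> f_gen aI.
pose Q m (x : rbar I0 (m.+1 + j)) := x * P j m.+1 f = P j m.+1 a.
have exQ m : exists x, Q m x.
  have /generatorP fm := f_gen m.+1.
  have : P j m.+1 a \in J (m.+1 + j)%N by exact/tilt_pillar_Phi.
  by move=> /fm[x Ex]; exists x.
have [x0 Qx0] := exQ 0%N.
have [||x [_ Hx]] := @dependent_choice_seq (fun m => rbar I0 (m.+1 + j)) Q
  (fun m x y => F (F y) = F x) x0 => //.
  move=> m x Qx; have [y Qy] := exQ m.+1.
  have fJ : P j m.+1 f \in J (m + j).+1 by exact: mem_generator.
  have [t Ht Et] : exists2 t, tor I0 (m + j).+1 t & F (F y - x) = F (bar (m + j).+1 t).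
    apply: (frob_annihilator (HI := HI) (g := P j m.+1 f)).
      have /generatorP fm := f_gen m.+1.
      by apply/fm; exact: ker_gen_pillar.
    rewrite mulrBl [x * _]Qx -(Phi_frob m.+1 f) -(Phi_frob m.+1 a) -Qy.
    by rewrite rmorphM subrr.
  (* The correction has to be made one level up, where [y] lives. Being torsion, it is killed by
     [f], so [y] remains a quotient. *)
  have [s Hs Es] := tor_frob_surj HT Ht.
  exists (y - bar (m + j).+2 s); split.
    rewrite /Q mulrBl [y * _]Qy [_ * P j m.+2 f]mulrC (pillar_tor HI Hs) ?subr0 //.
    exact: (mem_generator (f_gen m.+2)).
  by rewrite rmorphB /= Es rmorphB /= -Et rmorphB /= subKr.
have [|u Eu] := @tilt_mk j (fun m => F (x m)).
  by move=> m; exact: (Hx m).2.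
exists u; apply: tilt_ext => m.
by rewrite rmorphM Eu -(Phi_frob m f) -(Phi_frob m a) -(Hx m).1 rmorphM.
Qed.

Lemma tilt_generatorP j (f : T' j) :
  is_generator (I' j) f <-> forall m, is_generator (J (m + j)%N) (P j m f).
Proof.
split=> [f_gen m|f_gen]; first exact: Phi_generator.
apply/generatorP => a; split=> [|[u ->]]; first exact: Phi_dvd.
by apply/idealMl/(tilt_pillar_Phi 0); exact: mem_generator.
Qed.

Lemma tilt_pillar_principal j : principal (I' j).
Proof.
(* A generator is lifted from coordinate 1: for [j = 0] the ideal at coordinate 0 is zero, and a
   lift of its generator need not generate the next one. *)
have [g g_gen] := pillar_bar_principal HI j.+1.
have [f Ef] := @Phi_surj j 1 g.
have f1 : is_generator (J (1 + j)%N) (P j 1 f) by rewrite Ef.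
exists f; apply/tilt_generatorP; case=> [|m].
  by rewrite -Phi_frob; exact: generator_frob.
elim: m => [//|m IHm].
by apply: (frob_generator HI (k := m + j)); rewrite (Phi_frob m.+1 f).
Qed.

Lemma rcast_generator m n (e : m = n) (x : rbar I0 m) :
  is_generator (J m) x -> is_generator (J n) (rc e x).
Proof. by case: _ / e. Qed.

Lemma tilt_pillarX j : idealX (I' j.+1) p =i ext (trans T' j) (I' j).
Proof.
have [f f_gen] := tilt_pillar_principal j.+1.
(* If [f] is the sequence [b_0, b_1, ...], this is [F b_0, b_0, b_1, ...]; its transition image is
   [f ^ p] because [tbar (F x) = x ^ p]. *)
pose h' m : rbar I0 (m + j) := F (rc (addnS m j) (P j.+1 m f)).
have [m|h Eh] := @tilt_mk j h'.
  rewrite /h' -[X in _ = F (rc _ X)]Phi_frob; congr (F _).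
  by rewrite -(frob_proj_rcast p_pr H _ (addnS m.+1 j)).
have trh : trans T' j h = f ^+ p.
  apply: tilt_ext => m; rewrite Phi_trans Eh frob_projP !rmorphXn; congr (_ ^+ p).
  by move: (P _ _ _); case: _ / (addnS m j).
have h_gen : is_generator (I' j) h.
  apply/tilt_generatorP => m; rewrite Eh; apply: (generator_frob HI).
  by apply: rcast_generator; exact: Phi_generator.
have /generatorP E1 := idealX_generator p f_gen.
have /generatorP E2 := ext_generator (trans T' j) h_gen.
by move=> z; apply/idP/idP => [/E1[u ->]|/E2[u ->]]; [apply/E2|apply/E1];
  exists u; rewrite trh.
Qed.

End TiltPillars.

(** * Torsion of the tilt *)

Section TiltTorsion.
Variables (p : nat) (p_pr : prime p) (T : tower) (I0 : ideal (T 0%N)).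
Variables (HT : perfectoid_tower p_pr I0) (I : forall i, ideal (T i)).
Variable HI : pillars HT I.

Local Notation H := (pt_pi HT).
Local Notation F := (frob_proj H p_pr).
Local Notation bar i := (pibar I0 i).
Local Notation T' := (tilt p_pr H).
Local Notation P := (Phi p_pr H).
Local Notation I' := (tilt_pillar HI).
Local Notation rc e := (rcast (rbar I0) e).

(** Each term of [x] is [F] of the next, and the injective map [tbar] sends it to the [p]-th power
    of that next term. *)
Lemma tilt_frob_eq0 j (x : T' j) : x ^+ p = 0 -> x = 0.
Proof.
move=> xp0; apply: tilt_ext => m; rewrite rmorph0 -Phi_frob.
apply: (pi_inj H); rewrite frob_projP rmorph0 -rmorphXn xp0.
exact: rmorph0.
Qed.

Lemma tilt_reduced j (x : T' j) n : x ^+ n = 0 -> x = 0.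
Proof.
move=> xn0; have : x ^+ (p ^ n) = 0.
  by rewrite -(subnK (ltnW (ltn_expl n (prime_gt1 p_pr)))) exprD xn0 mulr0.
elim: n {xn0} => [|n IHn]; first by rewrite expr1.
by rewrite expnSr exprM => /tilt_frob_eq0.
Qed.

Lemma Phi_from0_eq0 j (x : T' 0%N) : x \in I' 0%N -> P j 0 (from0 T' j x) = 0.
Proof.
move=> xI; elim: j => [|j IHj].
  by apply: (pillar_bar0 HI); exact/(tilt_pillar_Phi HI 0).
rewrite [from0 T' j.+1 x]/(trans T' j (from0 T' j x)) Phi_trans IHj.
by rewrite !rmorph0.
Qed.

(** Injectivity of [F] on torsion carries the vanishing upward from coordinate 0. *)
Lemma Phi_mul_tor j m (x : T' j) t :
  P j 0 x = 0 -> tor I0 (m + j)%N t -> P j m x * bar (m + j) t = 0.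
Proof.
move=> x0; elim: m t => [|m IHm] t Ht; first by rewrite x0 mul0r.
have [s Hs Es] := tor_frob HT Ht.
by apply: (tor_mul_eq0 (HT := HT)) => //; rewrite Es Phi_frob IHm.
Qed.

Lemma rcast_ker_gen m n (e : m = n) (e' : m.+1 = n.+1) :
  rc e' (bar m.+1 (ker_gen HI m)) = bar n.+1 (ker_gen HI n).
Proof. by case: _ / e in e' *; rewrite (eq_irrelevance e' erefl). Qed.

(** For [j = 0], the kernel generator lies in the pillar, which the coordinate of [f] generates. The
    maps [tbar] preserve kernel generators and carry the divisibility to larger [j]. *)
Lemma ker_gen_dvd_Phi j m (f : T' 0%N) : is_generator (I' 0%N) f ->
  exists c, bar (m + j).+1 (ker_gen HI (m + j)) = c * P j m.+1 (from0 T' j f).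
Proof.
move=> f_gen; elim: j => [|j [c Ec]].
  have /generatorP fm := Phi_generator (m := m.+1) f_gen.
  by apply/fm; exact: ker_gen_pillar.
exists (rc (esym (addnS m.+1 j)) (tbar I0 _ c)).
rewrite [from0 T' j.+1 f]/(trans T' j (from0 T' j f)) Phi_trans -!rmorphM -Ec.
by rewrite tbar_bar -ker_genS (rcast_ker_gen (esym (addnS m j))).
Qed.

(** Forward, reducedness makes [f] itself kill [a], so [F] sends coordinate [m.+1] of [a] into the
    torsion. Conversely, elements of [I_0^flat] vanish at coordinate 0, hence kill torsion at every
    level. *)
Lemma tilt_torP j (a : T' j) :
  tor (I' 0%N) j a <-> forall m, exists2 t, tor I0 (m + j)%N t & P j m a = bar (m + j) t.
Proof.
split=> [Ha m|Ha x xI]; last first.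
  exists 1%N => //; rewrite expr1; apply: tilt_ext => m.
  have [t Ht Et] := Ha m; rewrite rmorphM Et rmorph0.
  by apply: Phi_mul_tor => //; exact: Phi_from0_eq0.
have [f f_gen] := tilt_pillar_principal HI 0.
have [n n_gt0 fna] := Ha _ (mem_generator f_gen).
have af0 : a * from0 T' j f = 0.
  apply: (@tilt_reduced _ _ n); rewrite exprMn -(prednK n_gt0) exprSr.
  by rewrite -mulrA (prednK n_gt0) -rmorphXn [a * _]mulrC fna mulr0.
have [t Ht Et] : exists2 t, tor I0 (m + j).+1 t & F (P j m.+1 a) = F (bar _ t).
  apply: frob_annihilator (ker_gen_dvd_Phi j m f_gen) _.
  by rewrite -rmorphM af0 rmorph0.
have [s Hs Es] := tor_frob HT Ht.
by exists s => //; rewrite -Phi_frob Et Es.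
Qed.

Lemma tilt_tor_eq0 j (a : T' j) : tor (I' 0%N) j a -> P j 0 a = 0 -> a = 0.
Proof.
move=> /tilt_torP Ha a0; apply: tilt_ext => m; rewrite rmorph0.
elim: m => [//|m IHm]; have [t Ht Et] := Ha m.+1.
by rewrite Et (@tor_frob_eq0 _ _ _ _ HT _ _ Ht) ?rmorph0 // -Et Phi_frob.
Qed.

Lemma tilt_tor_lift j t :
  tor I0 j t -> exists2 a : T' j, tor (I' 0%N) j a & P j 0 a = bar j t.
Proof.
move=> Ht.
have [||s [s0 Hs]] := @dependent_choice_seq (fun m => T (m + j)%N)
  (fun m => tor I0 (m + j)%N) (fun m x y => F (bar (m + j).+1 y) = bar (m + j) x) t.
- exact: Ht.
- by move=> m x Hx; have [y Hy Ey] := tor_frob_surj HT Hx; exists y.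
have [|a Ea] := @tilt_mk _ _ _ _ HT j (fun m => bar (m + j) (s m)).
  by move=> m; exact: (Hs m).2.
exists a; last by rewrite Ea s0.
by apply/tilt_torP => m; exists (s m); [exact: (Hs m).1|exact: Ea].
Qed.

(** The value 0 is a default for the case that no such [t] exists, which does not occur for torsion
    [a]. *)
Definition untilt_tor j (a : T' j) : T j :=
  xget 0 [set t | tor I0 j t /\ bar j t = P j 0 a].

Lemma untilt_torP j (a : T' j) : tor (I' 0%N) j a ->
  tor I0 j (untilt_tor a) /\ bar j (untilt_tor a) = P j 0 a.
Proof.
move=> /tilt_torP/(_ 0)[t Ht Et].
rewrite /untilt_tor; case: xgetP => [_ -> //|/(_ t)[]].
by split.
Qed.

Lemma untilt_tor_unique j (a : T' j) t : tor (I' 0%N) j a ->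
  tor I0 j t -> bar j t = P j 0 a -> untilt_tor a = t.
Proof.
move=> /untilt_torP[Ha Ea] Ht Et.
by apply: (tor_bar_inj HT) => //; rewrite Ea.
Qed.

Lemma untilt_tor_iso j : nonunital_iso (tor (I' 0%N) j) (tor I0 j) (@untilt_tor j).
Proof.
split=> [|a b Ha Hb|a b Ha Hb].
- split=> [a /untilt_torP[] //|a b /set_mem Ha /set_mem Hb Eab|t Ht].
    have [_ Ea] := untilt_torP Ha; have [_ Eb] := untilt_torP Hb.
    apply/eqP; rewrite -subr_eq0; apply/eqP/tilt_tor_eq0; first exact: torB.
    by rewrite rmorphB -Ea -Eb Eab subrr.
  have [a Ha Ea] := tilt_tor_lift Ht.
  by exists a => //; exact: untilt_tor_unique.
- have [Ua Ea] := untilt_torP Ha; have [Ub Eb] := untilt_torP Hb.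
  by apply: untilt_tor_unique; [exact: torD..|rewrite !rmorphD Ea Eb].
- have [Ua Ea] := untilt_torP Ha; have [Ub Eb] := untilt_torP Hb.
  by apply: untilt_tor_unique; [exact: torMl..|rewrite !rmorphM Ea Eb].
Qed.

Lemma untilt_tor_trans j (a : T' j) : tor (I' 0%N) j a ->
  untilt_tor (trans T' j a) = trans T j (untilt_tor a).
Proof.
move=> Ha; have [Ua Ea] := untilt_torP Ha.
apply: untilt_tor_unique; [exact: tor_trans..|].
(* At coordinate 0 the two indices are convertible, so the cast is the identity. *)
by rewrite -tbar_bar Ea Phi_trans (eq_irrelevance (esym (addnS 0 j)) erefl).
Qed.

End TiltTorsion.

Theorem theorem3p35 (p : nat) (p_pr : prime p) (T : tower) (I0 : ideal (T 0%N))
    (HT : perfectoid_tower p_pr I0) (I : forall i, ideal (T i))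
    (HI : pillars HT I) :
  let T' := tilt p_pr (pt_pi HT) in
  let Phi' := Phi p_pr (pt_pi HT) in
  let I' := tilt_pillar HI in
  (forall j : nat,
     [/\ forall f : T' j,
           is_generator (I' j) f <->
           forall i, is_generator (ext (pibar I0 (i + j)) (I (i + j)%N)) (Phi' j i f),
         principal (I' j) &
         idealX (I' j.+1) p =i ext (trans T' j) (I' j)]) /\
  (exists phi : forall j, T' j -> T j,
     (forall j, nonunital_iso (tor (I' 0%N) j) (tor I0 j) (phi j)) /\
     (forall j (x : T' j), tor (I' 0%N) j x ->
        phi j.+1 (trans T' j x) = trans T j (phi j x))).
Proof.
move=> T' Phi' I'; split=> [j|].
  split; [exact: tilt_generatorP|exact: tilt_pillar_principal|exact: tilt_pillarX].
exists (untilt_tor (HT := HT)); split; first exact: (untilt_tor_iso HI).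
exact: (untilt_tor_trans (HI := HI)).
Qed.
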